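(* Let $N>1$, $R>0$, $u_0>0$, let $f,g$ be locally Lipschitz non-negative increasing real functions, $G(s)=\int_0^s g(\sigma)\,d\sigma$, and let $\lambda>0$ satisfy $\lambda f(\tau)>\sqrt{2G(\tau)}$ for any $\tau>0$. Assume $\int_{r_0}^{\infty}\frac{ds}{\sqrt{G(s)}}<\infty$ for some $r_0>0$ and $$\lim_{\tau\to\infty}\frac{f(\tau)}{\sqrt{2G(\tau)}}=\infty.$$ Let $u^0(r,t)$ be the solution of the radial problem given in the context and $T_\infty$ its blow-up time. Then $$\liminf_{t\nearrow T_\infty}\frac{\Phi(u^0(R,t))}{T_\infty-t}\ge\lambda.$$ More precisely, if one also assumes $\limsup_{s\to\infty}\frac{\Phi(\eta s)}{\Phi(s)}<1$ for any $\eta>1$, then $$\limsup_{t\nearrow T_\infty}\frac{u^0(R,t)}{\Phi^{-1}(\lambda(T_\infty-t))}\le1.$$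
   Context: $\Phi(r)=\int_r^{+\infty}\frac{ds}{f(s)}$, a decreasing function with $\Phi(+\infty)=0$ and inverse $\Phi^{-1}$ (the integral is finite under the assumptions). The radial problem is $$-\frac{1}{r^{N-1}}\frac{\partial}{\partial r}\Big(r^{N-1}\frac{\partial u}{\partial r}(r,t)\Big)+g(u(r,t))=0,\ r<R,\ t>0;\qquad \frac{\partial u}{\partial r}(0,t)=0,\ t\ge0;$$ $$\frac{\partial u}{\partial t}(R,t)+\frac{\partial u}{\partial r}(R,t)=\lambda f(u(R,t)),\ t\ge0;\qquad u(R,0)=u_0>0.$$ $T_\infty$ is the first time at which $u^0(R,t)$ becomes infinite. *)

(* Defs.v *)
From HB Require Import structures.
From mathcomp Require Export all_boot all_order all_algebra.
From mathcomp Require Export all_classical all_reals all_analysis.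
Export Order.TTheory GRing.Theory Num.Theory.
Export numFieldNormedType.Exports.

Set Implicit Arguments.
Unset Strict Implicit.
Unset Printing Implicit Defensive.

#[global] Open Scope classical_set_scope.
#[global] Open Scope ring_scope.

Definition locally_lipschitz (R : realType) (f : R -> R) : Prop :=
  forall x : R, exists2 U, nbhs x U & [lipschitz f y | y in U].

(* Only used for s >= 0; for s < 0 this is 0, not an oriented integral. *)
Definition primitive0 (R : realType) (g : R -> R) (s : R) : R :=
  \int[@lebesgue_measure R]_(x in `[0, s]) g x.

Definition Phi (R : realType) (f : R -> R) (r : R) : R :=
  \int[@lebesgue_measure R]_(s in `[r, +oo[) (f s)^-1.

(* The inverse of Phi restricted to ]0, +oo[, where f is positive; the value 0
   outside the range of this restriction is a dummy. *)
Definition Phi_inv (R : realType) (f : R -> R) : R -> R :=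
  'pinv_(fun=> 0) `]0, +oo[ (Phi f).

Definition is_left_derive (R : realType) (h : R -> R) (x l : R) : Prop :=
  (h y - h x) / (y - x) @[y --> x^'-] --> l.

Definition is_right_derive (R : realType) (h : R -> R) (x l : R) : Prop :=
  (h y - h x) / (y - x) @[y --> x^'+] --> l.

(* Classical solution u(r, t), 0 <= r <= rad, 0 <= t < T, of the radial problem
   in dimension N. The witnesses ur and ut are the derivatives of u in r and of
   u(rad, .) in t, one-sided at the ends r = 0, r = rad and t = 0. No values of
   u outside [0, rad] x [0, T[ are involved. *)
Definition radial_solution (R : realType) (N : nat) (rad u0 lambda : R)
    (f g : R -> R) (T : R) (u : R -> R -> R) : Prop :=
  exists (ur : R -> R -> R) (ut : R -> R),
    [/\ forall t : R, 0 <= t < T ->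
          [/\ is_right_derive (u ^~ t) 0 (ur 0 t),
              forall r : R, 0 < r < rad -> is_derive r 1 (u ^~ t) (ur r t) &
              is_left_derive (u ^~ t) rad (ur rad t)],
        is_right_derive (u rad) 0 (ut 0) /\
          forall t : R, 0 < t < T -> is_derive t 1 (u rad) (ut t),
        forall t r : R, 0 < t < T -> 0 < r < rad ->
          let flux := fun s : R => s ^+ N.-1 * ur s t in
          derivable flux r 1 /\
          - (r ^+ N.-1)^-1 * 'D_1 flux r + g (u r t) = 0,
        forall t : R, 0 <= t < T ->
          ur 0 t = 0 /\ ut t + ur rad t = lambda * f (u rad t) &
        u rad 0 = u0].

(* u(rad, t) is finite for t < T by construction, so T is the first time at
   which u(rad, t) becomes infinite. *)
Definition blowup_time (R : realType) (rad : R) (u : R -> R -> R) (T : R) :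
    Prop :=
  0 < T /\ u rad t @[t --> T^'-] --> +oo.

(* Main.v *)
Require Import Defs.
From mathcomp Require Import measurable_realfun ring lra.

(** Write [G] for [primitive0 g] and [v t = u rad t].

    At a fixed time the profile [w r = u r t] with slope [p] satisfies
    [p' = g w - (N - 1) / r * p]. The flux [r ^ (N - 1) * p] is nondecreasing and
    vanishes at the centre, so [p >= 0]; hence [p' <= g w], and multiplying by
    [2 * p] shows that [p ^ 2 - 2 * G w] is nonincreasing as long as [w > 0]
    ([energy_le]). Starting where [w] reaches the level [1], or close to the
    centre if [w] stays above [1], one gets at the boundary
    [p rad <= sqrt (2 * G (v t)) + K] with [K] independent of time
    ([boundary_slope_le]). The additive constant is the price for not knowing
    the sign of [u] near the centre.

    The boundary condition thus reads [v' >= lambda * f v - sqrt (2 * G v) - K].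
    Both correction terms are negligible before [f v] as [v] blows up: the first
    by the limit of [f / sqrt (2 * G)], the second because [f] is unbounded: it is
    monotone, and [1 / f] is integrable at infinity by comparison with
    [1 / sqrt G]. Hence
    [v' >= lambda * (1 - e) * f v] near the blow-up time, i.e. the derivative
    [- v' / f v] of [Phi f (v t)] is at most [- lambda * (1 - e)]. Integrating up
    to the blow-up time yields [Phi f (v t) >= lambda * (1 - e) * (Tinf - t)]
    ([Phi_blowup_ge]), which is the first claim.

    The ratio hypothesis of the second claim says that multiplying the argument
    by [eta > 1] shrinks [Phi f] by a factor bounded away from [1], which turns
    this asymptotic lower bound on [Phi f (v t)] into the upper bound
    [v t <= eta * Phi_inv f (lambda * (Tinf - t))] ([limsup_blowup]). *)

Set Implicit Arguments.
Unset Strict Implicit.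

(** * One-variable calculus *)

Section Calculus.
Variable R : realType.
Implicit Types (h dh : R -> R) (a b x y l : R).

Lemma locally_lipschitz_continuous h : locally_lipschitz h -> continuous h.
Proof.
move=> hlip x; have [U nU [k [_ hk]]] := hlip x.
have kp : k < `|k| + 1 by rewrite (le_lt_trans (ler_norm k))// ltrDl.
have k0 : 0 < `|k| + 1 by rewrite ltr_wpDl.
apply/cvgrPdist_le => e e0.
near=> y.
have Uxy : (U `*` U) (x, y).
  split => /=; first exact: nbhs_singleton.
  by near: y.
apply: (le_trans (hk _ kp (x, y) Uxy)) => /=.
rewrite -ler_pdivlMl//.
near: y.
apply: cvgr_dist_le; first exact: cvg_id.
by rewrite mulr_gt0// invr_gt0.
Unshelve. all: by end_near. Qed.

Lemma le0_derive_le h dh a b : a <= b ->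
  (forall x, a <= x <= b -> is_derive x 1 h (dh x)) ->
  (forall x, a <= x <= b -> dh x <= 0) -> h b <= h a.
Proof.
move=> ab dhE dh0; rewrite -subr_le0.
have [x xab||c cab ->] := @MVT_segment R h dh a b ab.
- exact/dhE/subset_itv_oo_cc.
- by apply: derivable_within_continuous => x xab; have [] := dhE x xab.
- by rewrite mulr_le0_ge0 ?subr_ge0// dh0.
Qed.

Lemma is_derive_continuous h x l : is_derive x 1 h l -> {for x, continuous h}.
Proof.
by move=> [dh _]; apply: differentiable_continuous; exact/derivable1_diffP.
Qed.

Lemma is_derive_continuous_oo h dh a b :
  (forall x, a < x < b -> is_derive x 1 h (dh x)) ->
  {in `]a, b[, continuous h}.
Proof.
by move=> dhE z; rewrite in_itv/= => /dhE; exact: is_derive_continuous.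
Qed.

Lemma is_left_derive_cvg h b l :
  is_left_derive h b l -> h x @[x --> b^'-] --> h b.
Proof.
move=> hl; apply/subr_cvg0.
have <- : l * (b - b) = 0 by rewrite subrr mulr0.
have : (h x - h b) / (x - b) * (x - b) @[x --> b^'-] --> l * (b - b).
  apply: cvgM => //; apply: cvgB; last exact: cvg_cst.
  exact: (@cvg_at_left_filter _ _ id).
apply: cvg_trans; apply: near_eq_cvg; near=> x.
by rewrite divfK// subr_eq0 lt_eqF.
Unshelve. all: by end_near. Qed.

Lemma is_right_derive_cvg h b l :
  is_right_derive h b l -> h x @[x --> b^'+] --> h b.
Proof.
move=> hl; apply/subr_cvg0.
have <- : l * (b - b) = 0 by rewrite subrr mulr0.
have : (h x - h b) / (x - b) * (x - b) @[x --> b^'+] --> l * (b - b).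
  apply: cvgM => //; apply: cvgB; last exact: cvg_cst.
  exact: (@cvg_at_right_filter _ _ id).
apply: cvg_trans; apply: near_eq_cvg; near=> x.
by rewrite divfK// subr_eq0 gt_eqF.
Unshelve. all: by end_near. Qed.

(** The difference quotients defining a one-sided derivative at an end are
    values of the derivative at interior points, so a bound on the open
    interval passes to the end even where the derivative is discontinuous
    there. *)
Lemma left_derive_le h dh a b l B : a < b ->
  (forall x, a < x < b -> is_derive x 1 h (dh x)) ->
  is_left_derive h b l ->
  (forall x, a < x < b -> dh x <= B) -> l <= B.
Proof.
move=> ab dhE hl dhB; apply: (cvgr_to_le hl); near=> y.
have yb : y < b by [].
have ay : a < y by near: y; exact: nbhs_left_gt.
have dhE' x : x \in `]y, b[ -> is_derive x 1 h (dh x).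
  by rewrite in_itv/= => /andP[yx xb]; apply: dhE; rewrite xb (lt_trans ay).
have [|c] := @MVT R h dh y b yb dhE'.
  apply/continuous_within_itvP => //; split.
  - exact: is_derive_continuous_oo dhE'.
  - apply: cvg_at_right_filter.
    apply: (is_derive_continuous_oo dhE).
    by rewrite in_itv/= ay.
  - exact: is_left_derive_cvg hl.
rewrite in_itv/= => /andP[yc cb] hE.
rewrite -(opprB (h b)) -(opprB b) invrN mulrNN hE mulfK ?subr_eq0 ?gt_eqF//.
by rewrite dhB// cb (lt_trans ay).
Unshelve. all: by end_near. Qed.

Lemma right_derive_ge h dh a b l B : a < b ->
  (forall x, a < x < b -> is_derive x 1 h (dh x)) ->
  is_right_derive h a l ->
  (forall x, a < x < b -> B <= dh x) -> B <= l.
Proof.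
move=> ab dhE hl dhB; apply: (cvgr_to_ge hl); near=> y.
have ay : a < y by [].
have yb : y < b by near: y; exact: nbhs_right_lt.
have dhE' x : x \in `]a, y[ -> is_derive x 1 h (dh x).
  by rewrite in_itv/= => /andP[yx xb]; apply: dhE; rewrite yx (lt_trans xb).
have [|c] := @MVT R h dh a y ay dhE'.
  apply/continuous_within_itvP => //; split.
  - exact: is_derive_continuous_oo dhE'.
  - exact: is_right_derive_cvg hl.
  - apply: cvg_at_left_filter.
    apply: (is_derive_continuous_oo dhE).
    by rewrite in_itv/= ay.
rewrite in_itv/= => /andP[yc cb] ->.
rewrite mulfK ?subr_eq0 ?gt_eqF//.
by rewrite dhB// yc (lt_trans cb).
Unshelve. all: by end_near. Qed.

Lemma right_derive_le h dh a b l B : a < b ->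
  (forall x, a < x < b -> is_derive x 1 h (dh x)) ->
  is_right_derive h a l ->
  (forall x, a < x < b -> dh x <= B) -> l <= B.
Proof.
move=> ab dhE hl dhB; rewrite -lerN2.
apply: (@right_derive_ge (\- h) (\- dh) a b) => //.
- by move=> x xab; apply: is_deriveN; exact: dhE.
- rewrite /is_right_derive.
  under eq_fun do rewrite -opprD mulNr.
  exact: cvgN.
- by move=> x xab; rewrite lerN2 dhB.
Qed.

End Calculus.

Section Primitive.
Variables (R : realType) (g : R -> R).
Hypothesis g_cont : continuous g.

Lemma is_derive_primitive0 (x : R) : 0 < x ->
  is_derive x 1 (primitive0 g) (g x).
Proof.
move=> x0.
have xx1 : x < x + 1 by rewrite ltrDl.
have int : lebesgue_measure.-integrable `[0, x + 1] (EFin \o g).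
  apply: continuous_compact_integrable; first exact: segment_compact.
  exact: continuous_subspaceT.
have [dG GE] := continuous_FTC1_closed xx1 int x0 (@g_cont x).
by apply: DeriveDef => //; rewrite -derive1E.
Qed.

Hypothesis g_ge0 : forall s, 0 <= g s.

Lemma primitive0_ge0 (x : R) : 0 <= primitive0 g x.
Proof. exact: Rintegral_ge0. Qed.

Lemma primitive0_le (x y : R) : x <= y -> primitive0 g x <= primitive0 g y.
Proof.
move=> xy; have [x0|x0] := ltP 0 x; last first.
  suff -> : primitive0 g x = 0 by exact: primitive0_ge0.
  rewrite /primitive0; have [->|xn0] := eqVneq x 0.
    by rewrite set_itv1 Rintegral_set1.
  by rewrite set_itv_ge ?Rintegral_set0// bnd_simp -ltNge lt_neqAle xn0.
rewrite -lerN2.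
apply: (@le0_derive_le _ (\- primitive0 g) (\- g)) => // z /andP[xz _].
- by apply: is_deriveN; apply: is_derive_primitive0; exact: lt_le_trans xz.
- by rewrite oppr_le0.
Qed.

End Primitive.

(** * Boundary slope of a radial profile *)

Section RadialProfile.
Variables (R : realType) (m : nat) (rad : R) (g w p : R -> R).
Hypothesis rad_gt0 : 0 < rad.
Hypothesis g_cont : continuous g.
Hypothesis g_ge0 : forall s, 0 <= g s.
Hypothesis g_incr : {homo g : x y / x <= y}.
Hypothesis w_center : is_right_derive w 0 0.
Hypothesis w_derive : forall r : R, 0 < r < rad -> is_derive r 1 w (p r).
Hypothesis w_bnd : is_left_derive w rad (p rad).
Hypothesis flux_derive : forall r : R, 0 < r < rad ->
  is_derive r 1 (fun s => s ^+ m * p s) (r ^+ m * g (w r)).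

Let w_derive_lt (r : R) : r < rad ->
  forall x : R, 0 < x < r -> is_derive x 1 w (p x).
Proof.
by move=> rr x /andP[x0 xr]; apply: w_derive; rewrite x0 (lt_trans xr).
Qed.

(** The flux [r ^+ m * p r] is nondecreasing. Were it negative at some [r], the
    slope would stay below [p r < 0] all the way to the centre, against the zero
    slope there. *)
Lemma slope_ge0 (r : R) : 0 < r < rad -> 0 <= p r.
Proof.
move=> /andP[r0 rr]; rewrite leNgt; apply/negP => pr.
have H : forall x : R, 0 < x < r -> p x <= p r.
  move=> x /andP[x0 xr].
  have : x ^+ m * p x <= r ^+ m * p r.
    rewrite -lerN2.
    apply: (@le0_derive_le _ (fun s => - (s ^+ m * p s))
      (fun s => - (s ^+ m * g (w s)))).
    - exact: ltW.
    - move=> z /andP[xz zr]; apply: is_deriveN; apply: flux_derive.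
      by rewrite (lt_le_trans x0 xz) (le_lt_trans zr rr).
    - move=> z /andP[xz zr].
      by rewrite oppr_le0 mulr_ge0 ?exprn_ge0// ltW// (lt_le_trans x0 xz).
  move=> fl.
  have xm : 0 < x ^+ m by rewrite exprn_gt0.
  have : x ^+ m <= r ^+ m by rewrite lerXn2r ?nnegrE ?ltW.
  by move=> xrm; rewrite -(ler_pM2l xm) (le_trans fl)// ler_wnM2r// ltW.
have := right_derive_le r0 (w_derive_lt rr) w_center H; lra.
Qed.

Lemma slope_derive (r : R) : 0 < r < rad ->
  is_derive r 1 p (g (w r) - m%:R / r * p r).
Proof.
move=> rI; have /andP[r0 rr] := rI.
have rm : r ^+ m != 0 by rewrite expf_neq0// gt_eqF.
apply: (@near_eq_is_derive R R^o R^o (fun s => (s ^+ m * p s) * (s ^+ m)^-1)).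
  near=> s; rewrite mulrC mulKf// expf_neq0// gt_eqF//.
  by near: s; exact: lt_nbhsr.
have dflux := flux_derive rI.
have dX : is_derive r 1 (fun s : R => s ^+ m) (m%:R * r ^+ m.-1).
  apply: DeriveDef; first exact: exprn_derivable.
  by rewrite exp_derive /GRing.scale/= mulr1.
have dV := is_deriveV (f := fun s : R => s ^+ m) rm dX.
apply: (is_derive_eq (is_deriveM dflux dV)); rewrite /GRing.scale/=.
have rn0 : r != 0 by rewrite gt_eqF.
have -> : m%:R * r ^+ m.-1 = m%:R / r * r ^+ m.
  by case: (m) => [|k]; rewrite ?mul0r// exprS -mulrA mulKf.
field; exact/andP.
Unshelve. all: by end_near. Qed.

Lemma profile_nondecr (x y : R) : 0 < x -> x <= y -> y < rad -> w x <= w y.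
Proof.
move=> x0 xy yr; rewrite -lerN2.
apply: (@le0_derive_le _ (\- w) (\- p)) => // z /andP[xz zy].
- apply: is_deriveN; apply: w_derive.
  by rewrite (lt_le_trans x0 xz) (le_lt_trans zy yr).
- by rewrite oppr_le0 slope_ge0// (lt_le_trans x0 xz) (le_lt_trans zy yr).
Qed.

(** Since [p' <= g (w r)] on [(0, r)], the function [p x - g (w r) * x] is
    nonincreasing; were it positive at [r], [p] would be bounded below by a
    positive constant up to the centre, where the slope vanishes. This replaces
    an integration from [0], where [p] is not known to be continuous. *)
Lemma slope_le_linear (r : R) : 0 < r < rad -> p r <= g (w r) * r.
Proof.
move=> /andP[r0 rr]; rewrite leNgt; apply/negP => pr.
have H : forall x : R, 0 < x < r -> p r - g (w r) * r <= p x.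
  move=> x /andP[x0 xr].
  have inr (z : R) : x <= z <= r -> 0 < z < rad.
    by move=> /andP[xz zr]; rewrite (lt_le_trans x0 xz) (le_lt_trans zr rr).
  suff : p r - g (w r) * r <= p x - g (w r) * x.
    have : 0 <= g (w r) * x by rewrite mulr_ge0// ltW.
    lra.
  apply: (@le0_derive_le _ (fun s => p s - g (w r) * s)
    (fun s => (g (w s) - m%:R / s * p s) - g (w r)) _ _ (ltW xr)) => z zi.
    have dp := slope_derive (inr z zi).
    apply: is_derive_eq.
    by rewrite -[_%:A]/(_ * _) mulr1.
  have /andP[z0 zr] := inr z zi.
  have : g (w z) <= g (w r) by apply/g_incr/profile_nondecr => //; case/andP: zi.
  have : 0 <= m%:R / z * p z.
    by rewrite mulr_ge0 ?divr_ge0 ?slope_ge0 ?inr// ltW.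
  lra.
have := right_derive_ge r0 (w_derive_lt rr) w_center H; lra.
Qed.

(** Dropping the friction term [- m / r * p] from the equation leaves the
    conservative motion [w'' = g w], whose energy is [p ^+ 2 - 2 * G w]; friction
    only dissipates it. The profile has to be positive because [primitive0 g]
    vanishes on the negative axis and is an antiderivative of [g] only on the
    positive one. *)
Lemma energy_le (s r : R) : 0 < s -> s <= r -> r < rad -> 0 < w s ->
  p r ^+ 2 - 2 * primitive0 g (w r) <= p s ^+ 2 - 2 * primitive0 g (w s).
Proof.
move=> s0 sr rr ws0.
have inr (z : R) : s <= z <= r -> 0 < z < rad.
  by move=> /andP[xz zr]; rewrite (lt_le_trans s0 xz) (le_lt_trans zr rr).
apply: (@le0_derive_le _ (fun s => p s ^+ 2 - 2 * primitive0 g (w s))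
   (fun s => - (2 * (m%:R / s) * p s ^+ 2)) _ _ sr) => z zi.
  have /andP[sz zr] := zi; have /andP[z0 zrad] := inr z zi.
  have wz : 0 < w z by rewrite (lt_le_trans ws0)// profile_nondecr.
  have dp := slope_derive (inr z zi).
  have dG := is_derive_primitive0 g_cont wz.
  have dGw := is_derive1_comp dG (w_derive (inr z zi)).
  have dp2 := is_deriveM dp dp.
  have dGw2 := is_deriveZ 2 dGw.
  apply: (is_derive_eq (is_deriveB dp2 dGw2)); rewrite /GRing.scale/=.
  by set c := m%:R / z; ring.
rewrite oppr_le0 mulr_ge0 ?sqr_ge0// mulr_ge0// divr_ge0//.
by have /andP[/ltW] := inr z zi.
Qed.

(** The profile may be negative near the centre, so the energy estimate starts
    from a point [s] where [w s >= 1] and where the slope is already below the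
    constant [g 1 * rad + 1]: the point where the profile crosses the level [1],
    or, if it stays above [1], a point close to the centre. *)
Lemma slope_le_energy (r : R) : 0 < r < rad ->
  p r <= Num.sqrt (2 * primitive0 g (w r)) + (g 1 * rad + 1).
Proof.
move=> rI; have /andP[r0 rr] := rI.
set K := g 1 * rad + 1.
have K0 : 0 <= K by rewrite addr_ge0// mulr_ge0// ltW.
have [wr|wr] := leP (w r) 1.
  rewrite (le_trans (slope_le_linear rI))// (@le_trans _ _ K)//; last first.
    by rewrite lerDr sqrtr_ge0.
  rewrite (@le_trans _ _ (g 1 * rad))//; last by rewrite lerDl.
  by apply: ler_pM => //; [exact: ltW|exact: g_incr|exact: ltW].
suff [s [s0 sr ws ps]] : exists s, [/\ 0 < s, s <= r, 1 <= w s & p s <= K].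
  have ws0 : 0 < w s by exact: lt_le_trans ws.
  have := energy_le s0 sr rr ws0.
  have Gs := primitive0_ge0 g_ge0 (w s).
  have Gr := primitive0_ge0 g_ge0 (w r).
  have srad : 0 < s < rad by rewrite s0 (le_lt_trans sr).
  have ps0 := slope_ge0 srad; have pr0 := slope_ge0 rI.
  have Gr2 : 0 <= 2 * primitive0 g (w r) by rewrite mulr_ge0.
  have := sqr_sqrtr Gr2; have := sqrtr_ge0 (2 * primitive0 g (w r)).
  set q := Num.sqrt _ => q0 q2 E.
  have q2' : p r ^+ 2 <= q ^+ 2 + p s ^+ 2 by lra.
  have psK : p s ^+ 2 <= K ^+ 2 by rewrite lerXn2r.
  rewrite leNgt; apply/negP => prq.
  have : (q + K) ^+ 2 < p r ^+ 2 by rewrite ltr_pXn2r ?nnegrE// addr_ge0.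
  have : 0 <= q * K by rewrite mulr_ge0.
  rewrite sqrrD; lra.
have [[s0 /andP[s00 s0r] ws0]|nos] := pselect (exists2 s, 0 < s < r & w s <= 1).
  have [||s] := @IVT R w s0 r 1 (ltW s0r).
  - apply: derivable_within_continuous => x; rewrite in_itv/= => /andP[s0x xr].
    have xI : 0 < x < rad by rewrite (lt_le_trans s00 s0x) (le_lt_trans xr).
    by have [] := w_derive xI.
  - by rewrite ge_min ws0 le_max (ltW wr) orbT.
  rewrite in_itv/= => /andP[s0s sr] ws.
  have s_gt0 : 0 < s by exact: lt_le_trans s0s.
  exists s; split=> //; first by rewrite ws.
  have srad : 0 < s < rad by rewrite s_gt0 (le_lt_trans sr).
  rewrite (le_trans (slope_le_linear srad))// ws (@le_trans _ _ (g 1 * rad))//.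
    by rewrite ler_wpM2l// (le_trans sr)// ltW.
  by rewrite lerDl.
have gr0 : 0 < g (w r) + 1 by rewrite ltr_wpDl.
(* The second entry ensures [g (w r) * s <= 1]. *)
pose s := Num.min (r / 2) (g (w r) + 1)^-1.
have s0 : 0 < s by rewrite lt_min divr_gt0//= invr_gt0.
have sr : s < r.
  by rewrite (@le_lt_trans _ _ (r / 2)) ?ge_min ?lexx//; lra.
exists s; split => //; first exact: ltW.
  by rewrite leNgt; apply/negP => ws; apply: nos; exists s; rewrite ?s0// ltW.
have srad : 0 < s < rad by rewrite s0 (lt_trans sr).
rewrite (le_trans (slope_le_linear srad))// (@le_trans _ _ 1)//; last first.
  by rewrite lerDr mulr_ge0// ltW.
apply: (@le_trans _ _ ((g (w r) + 1) * (g (w r) + 1)^-1)); last first.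
  by rewrite divff ?gt_eqF.
apply: ler_pM => //; first exact: ltW.
  rewrite (@le_trans _ _ (g (w r)))// ?lerDl//.
  by apply/g_incr/profile_nondecr => //; exact: ltW.
by rewrite ge_min lexx orbT.
Qed.

Lemma boundary_slope_le :
  p rad <= Num.sqrt (2 * primitive0 g (w rad)) + (g 1 * rad + 1).
Proof.
apply: (left_derive_le rad_gt0 w_derive w_bnd) => r rI.
have /andP[r0 rr] := rI.
rewrite (le_trans (slope_le_energy rI))// lerD2r ler_wsqrtr// ler_pM2l//.
have wr_le : w r <= w rad.
  apply: (cvgr_to_ge (is_left_derive_cvg w_bnd)); near=> s.
  apply: profile_nondecr => //.
  by near: s; apply: nbhs_left_ge.
exact: primitive0_le.
Unshelve. all: by end_near. Qed.

End RadialProfile.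

(** * The function Phi *)

(** The integral of a nonnegative function is a supremum over the simple
    functions below it, hence monotone for arbitrary functions. The integrand
    [1 / sqrt G], infinite where [G] vanishes, can thus bound [1 / f] without
    establishing its measurability. *)
Lemma ge0_le_integral_pointwise d (T : measurableType d) (R : realType)
    (mu : {measure set T -> \bar R}) (D : set T) (h1 h2 : T -> \bar R) :
  (forall x, D x -> 0 <= h1 x)%E -> (forall x, D x -> h1 x <= h2 x)%E ->
  (\int[mu]_(x in D) h1 x <= \int[mu]_(x in D) h2 x)%E.
Proof.
move=> h10 h12; rewrite (integral_mkcond D h1) (integral_mkcond D h2).
have r12 := lee_restrict h12.
have r10 := erestrict_ge0 h10.
rewrite !ge0_integralTE//; last by move=> x; exact: le_trans (r12 x).
apply: le_ereal_sup => _ [h /= hh1 <-]; exists h => // x.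
exact: le_trans (r12 x).
Qed.

Section Phi.
Variables (R : realType) (f : R -> R).
Local Notation mu := (@lebesgue_measure R).
Hypothesis f_cont : continuous f.
Hypothesis f_gt0 : forall s : R, 0 < s -> 0 < f s.
Hypothesis f_incr : {homo f : x y / x <= y}.
Let h : R -> R := fun s => (f s)^-1.

Let h_gt0 (s : R) : 0 < s -> 0 < h s.
Proof. by move=> s0; rewrite invr_gt0 f_gt0. Qed.

Let h_cont (s : R) : 0 < s -> {for s, continuous h}.
Proof. by move=> s0; apply: cvgV; [rewrite gt_eqF// f_gt0|exact: f_cont]. Qed.

Let h_within (a : R) (b : itv_bound R) : 0 < a ->
  {within [set` Interval (BLeft a) b], continuous h}.
Proof.
move=> a0; apply: continuous_in_subspaceT => s; rewrite inE/= => sab.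
apply: h_cont; rewrite (lt_le_trans a0)//.
by move: sab; rewrite itv_boundlr/= => /andP[].
Qed.

Lemma inv_measurable (a : R) (b : itv_bound R) : 0 < a ->
  measurable_fun [set` Interval (BLeft a) b] h.
Proof.
by move=> a0; apply: subspace_continuous_measurable_fun => //; exact: h_within.
Qed.

Lemma inv_integrable_extend (r0 : R) : 0 < r0 ->
  mu.-integrable `[r0, +oo[ (EFin \o h) ->
  forall x : R, 0 < x -> mu.-integrable `[x, +oo[ (EFin \o h).
Proof.
move=> r00 hr0 x x0.
have [r0x|xr0] := leP r0 x.
  by apply: integrableS hr0 => //; apply: subset_itvr; rewrite bnd_simp.
have /integrableP[_ hx] : mu.-integrable `[x, r0] (EFin \o h).
  by apply: continuous_compact_integrable; [exact: segment_compact|exact: h_within].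
have /integrableP[_ hy] : mu.-integrable `]r0, +oo[ (EFin \o h).
  by apply: integrableS hr0 => //; apply: subset_itvr; rewrite bnd_simp.
apply/integrableP; split; first by apply/measurable_EFinP; exact: inv_measurable.
rewrite (@itv_bndbnd_setU _ _ _ (BRight r0)) ?bnd_simp ?ltW//.
rewrite ge0_integral_setU//=.
- exact: lte_add_pinfty.
- apply/measurable_EFinP; apply: measurableT_comp => //.
  rewrite -(@itv_bndbnd_setU _ _ (BLeft x) (BRight r0) +oo%O) ?bnd_simp ?ltW//.
  exact: inv_measurable.
- by apply/disj_setPS => z /=; rewrite !in_itv/= andbT => -[/andP[_ ?] ?]; lra.
Qed.

Hypothesis h_int : forall x : R, 0 < x -> mu.-integrable `[x, +oo[ (EFin \o h).

Lemma Phi_ge0 (x : R) : 0 < x -> 0 <= Phi f x.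
Proof.
move=> x0; apply: Rintegral_ge0 => s /=; rewrite in_itv/= andbT => xs.
by rewrite ltW// h_gt0// (lt_le_trans x0).
Qed.

Lemma is_derive_Phi (x : R) : 0 < x -> is_derive x 1 (Phi f) (- (f x)^-1).
Proof.
move=> x0; set a := x / 2.
have a0 : 0 < a by rewrite divr_gt0.
have ax : a < x by rewrite /a; lra.
have xx1 : x < x + 1 by rewrite ltrDl.
have hint : mu.-integrable `[a, x + 1] (EFin \o h).
  apply: continuous_compact_integrable; first exact: segment_compact.
  exact: h_within.
have [dI IE] := continuous_FTC1_closed xx1 hint ax (h_cont x0).
have {}dI : is_derive x 1
    (fun y => Phi f a - \int[mu]_(t in `[a, y]) h t) (0 - h x).
  apply: is_deriveB.
  by apply: DeriveDef => //; rewrite -derive1E.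
rewrite -[- _]add0r; apply: near_eq_is_derive dI.
near=> y.
have ay : a < y by near: y; exact: lt_nbhsr.
have := @Rintegral_itvB R h (BLeft a) +oo%O y (h_int a0).
rewrite !bnd_simp => /(_ (ltW ay) isT) ->.
apply: Rintegral_itv_obnd_cbnd.
by apply: integrableS (h_int a0) => //; apply: subset_itvr; rewrite bnd_simp ltW.
Unshelve. all: by end_near. Qed.

Lemma Phi_diff_ge (x y : R) : 0 < x -> x < y ->
  (y - x) / f y <= Phi f x - Phi f y.
Proof.
move=> x0 xy.
have d z : x <= z <= y -> is_derive z 1 (Phi f) (- (f z)^-1).
  by move=> /andP[xz _]; apply: is_derive_Phi; exact: lt_le_trans xz.
have [z zI||c cI E] := @MVT R (Phi f) (fun z => - (f z)^-1) x y xy.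
- exact/d/subset_itv_oo_cc.
- by apply: derivable_within_continuous => z zI; have [] := d z zI.
rewrite -[leRHS]opprB E mulNr opprK mulrC ler_pM2r ?subr_gt0//.
move: cI; rewrite in_itv/= => /andP[xc cy].
have c0 : 0 < c := lt_trans x0 xc.
have y0 : 0 < y := lt_trans c0 cy.
by rewrite lef_pV2 ?posrE; [exact/f_incr/ltW|exact: f_gt0|exact: f_gt0].
Qed.

Lemma Phi_lt (x y : R) : 0 < x -> x < y -> Phi f y < Phi f x.
Proof.
move=> x0 xy; rewrite -subr_gt0; apply: lt_le_trans (Phi_diff_ge x0 xy).
by rewrite divr_gt0 ?subr_gt0// f_gt0// (lt_trans x0).
Qed.

Lemma Phi_le (x y : R) : 0 < x -> x <= y -> Phi f y <= Phi f x.
Proof.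
by move=> x0; rewrite le_eqVlt => /predU1P[->//|xy]; exact/ltW/Phi_lt.
Qed.

Lemma Phi_gt0 (x : R) : 0 < x -> 0 < Phi f x.
Proof.
move=> x0; apply: (@le_lt_trans _ _ (Phi f (x + 1))).
  by apply: Phi_ge0; rewrite addr_gt0.
by apply: Phi_lt; rewrite ?ltrDl.
Qed.

(** [- Phi f] is nondecreasing and bounded, hence has a limit [L] at infinity; as
    it is an antiderivative of [1 / f], the integral of [1 / f] over [1, +oo[,
    which is [Phi f 1], equals [L + Phi f 1]. *)
Lemma Phi_cvg0 : Phi f x @[x --> +oo] --> 0.
Proof.
(* The truncation makes the function monotone on the whole line. *)
pose F (x : R) := - Phi f (Num.max x 1).
have max0 (x : R) : 0 < Num.max x 1 by rewrite lt_max ltr01 orbT.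
have F_nd : {homo F : x y / x <= y}.
  move=> x y xy; rewrite lerN2; apply: Phi_le => //.
  by rewrite ge_max le_max xy/= le_max lexx orbT.
have F_ub : has_ubound (range F).
  by exists 0 => _ [x _ <-]; rewrite oppr_le0 Phi_ge0.
have FL := nondecreasing_cvgr F_nd F_ub; set L := sup _ in FL.
have PL : - Phi f x @[x --> +oo] --> L.
  apply: cvg_trans FL; apply: near_eq_cvg; near=> x.
  by rewrite /F max_l//; near: x; exact: nbhs_pinfty_ge.
have dN (x : R) : 0 < x -> is_derive x 1 (fun x => - Phi f x) (h x).
  move=> x0; rewrite -[h x]opprK; apply: is_deriveN; exact: is_derive_Phi.
have E : Phi f 1 = L - - Phi f 1.
  apply: (@Rintegral_ge0_continuous_FTC2y R h (fun x => - Phi f x)) => //.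
  - by move=> x x1; rewrite ltW// h_gt0// (lt_le_trans _ x1).
  - exact: h_within.
  - by move=> x x1; have [] := dN x (lt_trans ltr01 x1).
  - apply: cvg_at_right_filter.
    exact: is_derive_continuous (dN 1 ltr01).
  - move=> x; rewrite in_itv/= andbT => x1.
    have d := dN x (lt_trans ltr01 x1).
    by rewrite derive1E (@derive_val _ _ _ _ _ _ _ d).
have L0 : L = 0 by lra.
by rewrite -oppr0 -L0; under eq_fun do rewrite -[Phi _ _]opprK; exact: cvgN.
Unshelve. all: by end_near. Qed.

(** A nondecreasing function with an integrable inverse is unbounded:
    [(x - 1) / f x <= Phi f 1]. *)
Lemma f_cvg_pinfty : f x @[x --> +oo] --> +oo.
Proof.
have P1 : 0 < Phi f 1 by exact: Phi_gt0.
apply/cvgryPge => A; near=> x.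
have x1 : 1 < x by near: x; apply: nbhs_pinfty_gt; exact: num_real.
have fx : 0 < f x by rewrite f_gt0// (lt_trans ltr01).
have := Phi_diff_ge ltr01 x1.
have : 0 <= Phi f x by apply: Phi_ge0; exact: lt_trans x1.
move=> Px H; have {Px}H : (x - 1) / f x <= Phi f 1 by lra.
rewrite -(ler_pM2l P1); move: H; rewrite ler_pdivrMr//; apply: le_trans.
by rewrite lerBrDr; near: x; apply: nbhs_pinfty_ge; exact: num_real.
Unshelve. all: by end_near. Qed.

Lemma Phi_surj (c : R) : 0 < c -> c <= Phi f 1 ->
  exists2 y, 1 <= y & Phi f y = c.
Proof.
move=> c0 c1.
have [M M1 Mc] : exists2 M, 1 <= M & Phi f M <= c.
  near (+oo : set_system R) => M; exists M.
    by near: M; exact: nbhs_pinfty_ge.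
  by near: M; exact: (cvgr_le _ Phi_cvg0).
have [||y] := @IVT R (Phi f) 1 M c M1.
- apply: derivable_within_continuous => z; rewrite in_itv/= => /andP[z1 _].
  by have [] := is_derive_Phi (lt_le_trans ltr01 z1).
- by rewrite ge_min Mc orbT le_max c1.
by rewrite in_itv/= => /andP[y1 _] <-; exists y.
Unshelve. all: by end_near. Qed.

End Phi.

(** The hypothesis [sqrt (2 * G) < lambda * f] gives
    [1 / (lambda * f) <= 1 / sqrt G]. *)
Lemma inv_integrable (R : realType) (f g : R -> R) (lambda r0 : R) :
  continuous f -> (forall s, 0 <= g s) -> 0 < lambda -> 0 < r0 ->
  (forall s : R, 0 < s -> Num.sqrt (2 * primitive0 g s) < lambda * f s) ->
  (\int[lebesgue_measure]_(s in `[r0, +oo[) ((Num.sqrt (primitive0 g s))%:E)^-1 < +oo)%E ->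
  lebesgue_measure.-integrable `[r0, +oo[ (EFin \o (fun s => (f s)^-1)).
Proof.
move=> f_cont g_ge0 l0 r00 f_gt Gint.
have lf_gt0 s : 0 < s -> 0 < lambda * f s.
  by move=> s0; apply: le_lt_trans (f_gt _ s0); exact: sqrtr_ge0.
have f_gt0 s : 0 < s -> 0 < f s.
  by move=> /lf_gt0; rewrite pmulr_rgt0.
have mf : measurable_fun `[r0, +oo[ (fun s => (f s)^-1).
  exact: inv_measurable.
have : lebesgue_measure.-integrable `[r0, +oo[ (fun s => (lambda^-1%:E * ((f s)^-1)%:E)%E).
  apply/integrableP; split.
    by apply: measurable_funeM; apply/measurable_EFinP.
  apply: le_lt_trans Gint; apply: ge0_le_integral_pointwise => // s /=.
  rewrite in_itv/= andbT => r0s.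
  have s0 : 0 < s by exact: lt_le_trans r0s.
  have := lf_gt0 _ s0; have := f_gt _ s0.
  rewrite /= -invfM => lt lf0.
  rewrite ger0_norm; last by rewrite invr_ge0 ltW.
  rewrite inver; case: ifPn => [_|G0]; first exact: leey.
  rewrite lee_fin lef_pV2 ?posrE//; last by rewrite lt_neqAle eq_sym G0 sqrtr_ge0.
  rewrite (le_trans _ (ltW lt))// ler_wsqrtr//.
  by rewrite ler_peMl ?ler1n// primitive0_ge0.
move=> kint; have /(_ (measurable_itv _)) := @integrableZl _ _ _ _ _ _ lambda _ kint.
apply: eq_integrable => // s _ /=.
by rewrite -!EFinM mulrA divff ?mul1r// gt_eqF.
Qed.

(** * Limits inferior and superior *)

Section Limf.
Local Open Scope ereal_scope.
Variables (T : choiceType) (X : filteredType T) (R : realType).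
Variables (F : set_system X) (h : X -> \bar R).

Lemma limf_einf_ge (c : \bar R) :
  (\forall t \near F, c <= h t) -> c <= limf_einf h F.
Proof.
move=> ch; rewrite limf_einfE; apply: le_ereal_sup_tmp.
exists (ereal_inf (h @` [set t | c <= h t])); last first.
  by apply/ereal_infP => _ [t /= ct <-].
by exists [set t | c <= h t].
Qed.

Lemma limf_esup_le (c : \bar R) :
  (\forall t \near F, h t <= c) -> limf_esup h F <= c.
Proof.
move=> ch; rewrite limf_esupE; apply: ge_ereal_inf.
exists (ereal_sup (h @` [set t | h t <= c])); last first.
  by apply/ereal_supP => _ [t /= ct <-].
by exists [set t | h t <= c].
Qed.

Lemma limf_esup_lt {FF : Filter F} (c : R) : limf_esup h F < c%:E ->
  exists2 b : R, (b < c)%R & \forall t \near F, h t <= b%:E.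
Proof.
rewrite limf_esupE => /ereal_inf_lt[_ [V FV <-]] Vc.
suff [b bc Vb] : exists2 b : R, (b < c)%R & ereal_sup (h @` V) <= b%:E.
  exists b => //; apply: filterS FV => t Vt; apply: le_trans Vb.
  by apply: ereal_sup_ubound; exists t.
case: (ereal_sup _) Vc => [b|//|] bc; first by exists b; rewrite -?lte_fin.
by exists (c - 1)%R; rewrite ?ltrBlDr ?ltrDl// leNye.
Qed.

End Limf.

(** * Blow-up rate at the boundary *)

Section BlowUp.
Variables (R : realType) (f g : R -> R) (lambda K T : R) (v dv : R -> R).
Local Notation mu := (@lebesgue_measure R).
Hypothesis f_cont : continuous f.
Hypothesis f_gt0 : forall s : R, 0 < s -> 0 < f s.
Hypothesis f_incr : {homo f : x y / x <= y}.
Hypothesis f_int : forall x : R, 0 < x ->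
  mu.-integrable `[x, +oo[ (EFin \o (fun s => (f s)^-1)).
Hypothesis lambda_gt0 : 0 < lambda.
Hypothesis f_G : f s / Num.sqrt (2 * primitive0 g s) @[s --> +oo] --> +oo.
Hypothesis T_gt0 : 0 < T.
Hypothesis v_derive : forall t : R, 0 < t < T -> is_derive t 1 v (dv t).
Hypothesis v_growth : forall t : R, 0 < t < T ->
  lambda * f (v t) <= dv t + (Num.sqrt (2 * primitive0 g (v t)) + K).
Hypothesis v_blowup : v t @[t --> T^'-] --> +oo.

Lemma boundary_slope_negligible (e : R) : 0 < e ->
  \forall s \near +oo, Num.sqrt (2 * primitive0 g s) + K <= e * f s.
Proof.
move=> e0.
have e2 : 0 < e / 2 by rewrite divr_gt0.
have /cvgryPge fy := f_cvg_pinfty f_cont f_gt0 f_incr f_int.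
have /cvgryPge fG := f_G.
near=> s.
have s0 : 0 < s by near: s; exact: nbhs_pinfty_gt.
have KF : K <= e / 2 * f s.
  rewrite -ler_pdivrMl//; near: s; exact: fy.
have fGs : (e / 2)^-1 <= f s / Num.sqrt (2 * primitive0 g s) by near: s; exact: fG.
suff : Num.sqrt (2 * primitive0 g s) <= e / 2 * f s by lra.
have [->|q0] := eqVneq (Num.sqrt (2 * primitive0 g s)) 0.
  by rewrite mulr_ge0// ltW// f_gt0.
have {}q0 : 0 < Num.sqrt (2 * primitive0 g s).
  by rewrite lt_neqAle eq_sym q0 sqrtr_ge0.
by move: fGs; rewrite ler_pdivlMr// ler_pdivrMl.
Unshelve. all: by end_near. Qed.

(** Near [T] the growth hypothesis gives [dv >= (1 - e) * lambda * f v], that is,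
    [Phi f (v t) + (1 - e) * lambda * t] is nonincreasing; its limit at [T] is at
    least [(1 - e) * lambda * T] because [Phi f] is nonnegative. *)
Lemma Phi_blowup_ge (e : R) : 0 < e ->
  \forall t \near T^'-, 0 < v t /\ (1 - e) * (lambda * (T - t)) <= Phi f (v t).
Proof.
move=> e0.
have le0 : 0 < lambda * e by rewrite mulr_gt0.
have [d d0 near_v] : exists2 d : R, 0 < d &
    forall t : R, T - d < t < T -> 0 < v t /\
      Num.sqrt (2 * primitive0 g (v t)) + K <= lambda * e * f (v t).
  have : \forall t \near T^'-, 0 < v t /\
      Num.sqrt (2 * primitive0 g (v t)) + K <= lambda * e * f (v t).
    suff large : \forall s \near +oo, 0 < s /\
        Num.sqrt (2 * primitive0 g s) + K <= lambda * e * f s.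
      exact: (v_blowup large).
    near=> s; split; first by near: s; exact: nbhs_pinfty_gt.
    by near: s; exact: boundary_slope_negligible.
  move=> /nbhs_ballP[d /= d0 dv_near]; exists d => // t /andP[Tdt tT].
  apply: dv_near => //=; rewrite /ball/= gtr0_norm ?subr_gt0//; lra.
pose T0 := Num.max 0 (T - d).
have T0T : T0 < T by rewrite gt_max T_gt0/=; lra.
have T0P (t : R) : T0 < t < T -> 0 < t < T /\ T - d < t < T.
  by move=> /andP[]; rewrite gt_max => /andP[-> ->] ->.
have Phi_decay (t s : R) : T0 < t -> t <= s -> s < T ->
    Phi f (v s) + (1 - e) * lambda * s <= Phi f (v t) + (1 - e) * lambda * t.
  move=> T0t ts sT.
  apply: (@le0_derive_le _ (fun t => Phi f (v t) + (1 - e) * lambda * t)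
    (fun t => - (f (v t))^-1 * dv t + (1 - e) * lambda) _ _ ts) => x /andP[tx xs].
    have [|xI xI'] := T0P x; first by rewrite (lt_le_trans T0t tx) (le_lt_trans xs).
    have [vx _] := near_v x xI'.
    have dP := is_derive1_comp (is_derive_Phi f_cont f_gt0 f_int vx) (v_derive xI).
    have dL := is_deriveZ ((1 - e) * lambda) (is_derive_id x 1).
    apply: (is_derive_eq (is_deriveD dP dL)).
    by rewrite /GRing.scale/= mulr1.
  have [|xI xI'] := T0P x; first by rewrite (lt_le_trans T0t tx) (le_lt_trans xs).
  have [vx Hx] := near_v x xI'.
  have fx := f_gt0 vx; have growth := v_growth xI.
  rewrite mulNr addrC subr_le0 mulrC [leRHS]mulrC ler_pdivlMr//; lra.
near=> t.
have tT : t < T by [].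
have T0t : T0 < t by near: t; exact: nbhs_left_gt.
have v_gt0 (s : R) : T0 < s -> s < T -> 0 < v s.
  by move=> T0s sT; have [|_ /near_v[]//] := T0P s; rewrite T0s.
split; first exact: v_gt0.
suff : (1 - e) * lambda * T <= Phi f (v t) + (1 - e) * lambda * t by lra.
have : (1 - e) * lambda * s @[s --> T^'-] --> (1 - e) * lambda * T.
  by apply: cvgMr; exact: (@cvg_at_left_filter _ _ id).
move=> /cvgr_to_le; apply; near=> s.
have ts : t <= s by near: s; exact: nbhs_left_ge.
have sT : s < T by [].
have := Phi_decay t s T0t ts sT.
have T0s : T0 < s := lt_le_trans T0t ts.
have := Phi_ge0 f_gt0 (v_gt0 s T0s sT); lra.
Unshelve. all: by end_near. Qed.

Lemma liminf_Phi_blowup :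
  (lambda%:E <= limf_einf (fun t => (Phi f (v t) / (T - t))%:E) (T^'-))%E.
Proof.
apply/lee_subgt0Pr => e e0; apply: limf_einf_ge.
have el : 0 < e / lambda by rewrite divr_gt0.
have H := Phi_blowup_ge el.
near=> t.
have tT : 0 < T - t by rewrite subr_gt0.
rewrite -EFinB lee_fin ler_pdivlMr//.
have [_] : 0 < v t /\
    (1 - e / lambda) * (lambda * (T - t)) <= Phi f (v t) by near: t.
by rewrite mulrA mulrBl mul1r divfK// gt_eqF.
Unshelve. all: by end_near. Qed.

(** Put [y = Phi_inv f (lambda * (T - t))]. If [v t] exceeded [eta * y], then
    [Phi f (v t) < Phi f (eta * y) <= th * Phi f y] with [th < 1], whereas
    [Phi_blowup_ge] bounds [Phi f (v t)] below by a fraction of [Phi f y] as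
    close to [1] as desired. *)
Lemma limsup_blowup :
  (forall eta : R, 1 < eta ->
      (limf_esup (fun s => (Phi f (eta * s) / Phi f s)%:E) +oo%R < 1%:E)%E) ->
   (limf_esup (fun t => (v t / Phi_inv f (lambda * (T - t)))%:E)
      (T^'-) <= 1%:E)%E.
Proof.
move=> Phi_ratio; apply/lee_addgt0Pr => e e0; rewrite -EFinD.
set eta := 1 + e.
have eta1 : 1 < eta by rewrite ltrDl.
have [b b1 ratio_b] := limf_esup_lt (Phi_ratio eta eta1).
pose th := Num.max b 0.
have th1 : th < 1 by rewrite gt_max b1 ltr01.
(* [1 - (1 - th) / 2] lies strictly between [th] and [1]. *)
have gap : 0 < (1 - th) / 2 by rewrite divr_gt0// subr_gt0.
have near_ge := Phi_blowup_ge gap.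
have [M M1 ratio_M] : exists2 M : R, 1 <= M &
    forall s, M <= s -> Phi f (eta * s) <= th * Phi f s.
  move: ratio_b => [M0 [_ M0P]].
  exists (Num.max 1 (M0 + 1)); first by rewrite le_max lexx.
  move=> s; rewrite ge_max => /andP[s1 sM0].
  have s0 : 0 < s by exact: lt_le_trans s1.
  have := M0P s; rewrite lee_fin ler_pdivrMr ?Phi_gt0//.
  move=> /(_ _)/le_trans; apply; first lra.
  by rewrite ler_pM2r ?Phi_gt0// le_max lexx.
have M0 : 0 < M by exact: lt_le_trans M1.
apply: limf_esup_le; near=> t.
have tT : 0 < T - t by rewrite subr_gt0.
pose c := lambda * (T - t).
have c0 : 0 < c by rewrite mulr_gt0.
have cM : c <= Phi f M.
  rewrite -ler_pdivlMl// lerBlDr -lerBlDl; near: t; apply: nbhs_left_ge.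
  by rewrite ltrBlDr ltrDl mulr_gt0 ?invr_gt0// Phi_gt0.
have [y y1 yc] : exists2 y, 1 <= y & Phi f y = c.
  by apply: Phi_surj => //; rewrite (le_trans cM)// Phi_le.
have y0 : 0 < y by exact: lt_le_trans y1.
have Phi_inj : {in `]0, +oo[%classic &, injective (Phi f)}.
  move=> x z; rewrite !inE/= !in_itv/= !andbT => x0 z0 xz.
  have [xz'|xz'|//] := ltgtP x z.
    by have := Phi_lt f_cont f_gt0 f_incr f_int x0 xz'; rewrite xz ltxx.
  by have := Phi_lt f_cont f_gt0 f_incr f_int z0 xz'; rewrite xz ltxx.
have -> : Phi_inv f (lambda * (T - t)) = y.
  rewrite -/c -yc /Phi_inv pinvKV// inE/= in_itv/= andbT//.
rewrite lee_fin ler_pdivrMr// leNgt; apply/negP => ev.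
have [v0 Pv] : 0 < v t /\
    (1 - (1 - th) / 2) * (lambda * (T - t)) <= Phi f (v t).
  by near: t.
have My : M <= y.
  rewrite leNgt; apply/negP => yM.
  by have := Phi_lt f_cont f_gt0 f_incr f_int y0 yM; rewrite yc ltNge cM.
have ey0 : 0 < eta * y by rewrite mulr_gt0// (lt_trans ltr01).
have := Phi_lt f_cont f_gt0 f_incr f_int ey0 ev.
have := ratio_M y My; rewrite yc; rewrite -/c in Pv.
have : 0 < (1 - th) / 2 * c by rewrite mulr_gt0.
lra.
Unshelve. all: by end_near. Qed.

End BlowUp.

Theorem theorem6 (R : realType) (N : nat) (rad u0 lambda : R) (f g : R -> R)
  (u : R -> R -> R) (Tinf : R)
  (N_gt1 : (1 < N)%N) (rad_gt0 : 0 < rad) (u0_gt0 : 0 < u0)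
  (f_lip : locally_lipschitz f) (g_lip : locally_lipschitz g)
  (f_ge0 : forall s, 0 <= f s) (g_ge0 : forall s, 0 <= g s)
  (f_incr : {homo f : x y / x <= y}) (g_incr : {homo g : x y / x <= y})
  (lambda_gt0 : 0 < lambda)
  (f_gt : forall tau, 0 < tau ->
     Num.sqrt (2 * primitive0 g tau) < lambda * f tau)
  (G_int : exists2 r0 : R, 0 < r0 &
     (\int[@lebesgue_measure R]_(s in `[r0, +oo[)
        ((Num.sqrt (primitive0 g s))%:E)^-1 < +oo)%E)
  (f_G_lim : f tau / Num.sqrt (2 * primitive0 g tau) @[tau --> +oo] --> +oo)
  (u_sol : radial_solution N rad u0 lambda f g Tinf u)
  (Tinf_blowup : blowup_time rad u Tinf) :
  (lambda%:E <=
     limf_einf (fun t => (Phi f (u rad t) / (Tinf - t))%:E) (Tinf^'-))%E /\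
  ((forall eta : R, 1 < eta ->
      (limf_esup (fun s => (Phi f (eta * s) / Phi f s)%:E) +oo%R < 1%:E)%E) ->
   (limf_esup (fun t => (u rad t / Phi_inv f (lambda * (Tinf - t)))%:E)
      (Tinf^'-) <= 1%:E)%E).
Proof.
have f_cont := locally_lipschitz_continuous f_lip.
have g_cont := locally_lipschitz_continuous g_lip.
have f_gt0 s : 0 < s -> 0 < f s.
  move=> s0; rewrite -(pmulr_rgt0 _ lambda_gt0).
  by apply: le_lt_trans (f_gt s s0); exact: sqrtr_ge0.
have [r0 r0_gt0 r0_int] := G_int.
have f_int := inv_integrable_extend f_cont f_gt0 r0_gt0
  (inv_integrable f_cont g_ge0 lambda_gt0 r0_gt0 f_gt r0_int).
have [T_gt0 v_blowup] := Tinf_blowup.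
have [ur [ut [u_r [_ v_derive] pde bc _]]] := u_sol.
have v_growth t : 0 < t < Tinf -> lambda * f (u rad t) <=
    ut t + (Num.sqrt (2 * primitive0 g (u rad t)) + (g 1 * rad + 1)).
  move=> tI; have /andP[/ltW t0 tT] := tI.
  have t0T : 0 <= t < Tinf by rewrite t0.
  have [ur0 <-] := bc t t0T; rewrite lerD2l.
  have [w_center w_derive w_bnd] := u_r t t0T; rewrite ur0 in w_center.
  apply: (@boundary_slope_le _ N.-1 rad g (u ^~ t) (ur ^~ t)) => // r rI.
  have [dflux fluxE] := pde t r tI rI.
  apply: DeriveDef => //; have /andP[r_gt0 _] := rI.
  have rn0 : r ^+ N.-1 != 0 by rewrite expf_neq0// gt_eqF.
  have -> : g (u r t) = (r ^+ N.-1)^-1 * 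
      'D_1 (fun s : R => s ^+ N.-1 * ur s t) r.
    by apply/eqP; rewrite -subr_eq0 addrC -mulNr fluxE.
  by rewrite mulVKf.
split.
  exact: (liminf_Phi_blowup f_cont f_gt0 f_incr f_int lambda_gt0 f_G_lim T_gt0
    v_derive v_growth v_blowup).
exact: (limsup_blowup f_cont f_gt0 f_incr f_int lambda_gt0 f_G_lim T_gt0
  v_derive v_growth v_blowup).
Qed.
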